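(* Fix a user density $\delta>0$ and a distance threshold $r>0$. For each positive integer $K$, let $K$ users and $N=N_K\ge 1$ RRHs be uniformly distributed over a square of side length $r_0=r_0(K)$ with $r_0^2=K/\delta$, so that $r_0^2\to\infty$ as $K\to\infty$ with $\delta=K/r_0^2$ fixed. Let $L_K$ be the minimum training length preserving local orthogonality. Then $L_K$ scales at most in the order of $\ln K$ as $K\to\infty$, i.e. $$\limsup_{K\to\infty}\frac{L_K}{\ln K}<\infty\quad\text{almost surely}.$$
   Context: Setup: user positions are $\mathbf{u}_k\in\mathbb{R}^2$, $k\in\mathcal{U}=\{1,\dots,K\}$, and RRH positions are $\mathbf{b}_i\in\mathbb{R}^2$, $i\in\{1,\dots,N\}$. For the almost-sure statement, the users are realized as $\mathbf{u}_k=r_0(K)\,\tilde{\mathbf{u}}_k$, $k=1,\dots,K$, where $\tilde{\mathbf{u}}_1,\tilde{\mathbf{u}}_2,\dots$ is a single i.i.d. sequence uniform on $[0,1]^2$; the RRHs are random points uniform on $[0,r_0(K)]^2$, defined on the same probability space, and their number $N_K$ is arbitrary. User $k$ is served by RRH $i$ if $\|\mathbf{b}_i-\mathbf{u}_k\|_\infty<r$; $\mathcal{U}_i$ denotes the set of users served by RRH $i$. Each user $k$ is assigned a training sequence $\mathbf{x}_k\in\mathbb{C}^{1\times L}$, where the positive integer $L$ is the training length; the sequences are nonzero and are taken, up to nonzero scaling, from a pool of mutually orthogonal sequences (so any two are either orthogonal or nonzero scalar multiples of each other). The assignment preserves local orthogonality if for every RRH $i$ the sequences $\{\mathbf{x}_k:k\in\mathcal{U}_i\}$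 are mutually orthogonal. The minimum training length $L_K$ is the smallest $L$ for which such an assignment exists; equivalently, it is the chromatic number of the graph $G$ on $\mathcal{U}$ in which two distinct users are adjacent if and only if they are served by a common RRH. *)

(* Defs.v *)
From HB Require Import structures.
From mathcomp Require Import all_boot all_order all_algebra.
From mathcomp Require Import complex.
From mathcomp Require Import all_classical all_reals all_analysis.

Set Implicit Arguments.
Unset Strict Implicit.
Unset Printing Implicit Defensive.

Import Order.TTheory GRing.Theory Num.Theory.
Import numFieldNormedType.Exports.

Local Open Scope classical_set_scope.
Local Open Scope ring_scope.

Section Training.
Variables (R : realType) (K N : nat).
Implicit Types (L : nat) (u : 'I_K -> R * R) (b : 'I_N -> R * R).

(* The norm of [R * R] is the sup norm ([prod_normE]). *)
Definition served (r : R) u b (i : 'I_N) : {set 'I_K} :=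
  [set k | `|b i - u k| < r].

Definition orthogonal_pool L (pool : set 'rV[R[i]]_L) : Prop :=
  forall p q, pool p -> pool q -> p <> q -> dotmx p q = 0.

Definition training_assignment L (x : 'I_K -> 'rV[R[i]]_L) : Prop :=
  (forall k, x k != 0) /\
  exists2 pool : set 'rV[R[i]]_L, orthogonal_pool pool &
    forall k, exists p a, [/\ pool p, a != 0 & x k = a *: p].

(* Orthogonality is that of the family indexed by the users: two distinct users
   of the same RRH may not share a sequence. *)
Definition locally_orthogonal (r : R) u b L (x : 'I_K -> 'rV[R[i]]_L) : Prop :=
  forall (i : 'I_N) (k l : 'I_K),
    k \in served r u b i -> l \in served r u b i -> k != l ->
    dotmx (x k) (x l) = 0.

Definition admissible_length (r : R) u b L : Prop :=
  (0 < L)%N /\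
  exists x : 'I_K -> 'rV[R[i]]_L,
    training_assignment x /\ locally_orthogonal r u b x.

Lemma admissible_length_exists (r : R) u b :
  exists L, `[< admissible_length r u b L >].
Proof.
have dotd (k l : 'I_K.+1) : k != l ->
    dotmx (delta_mx 0 k : 'rV[R[i]]_K.+1) (delta_mx 0 l) = 0.
  move=> kl; rewrite dotmxE mxE big1// => j _; rewrite !mxE eqxx/=.
  case: (eqVneq j k) => [->|_]; last by rewrite mul0r.
  by rewrite (negbTE kl) conjC0 mulr0.
pose e (k : 'I_K.+1) : 'rV[R[i]]_K.+1 := delta_mx 0 k.
pose x (k : 'I_K) := e (widen_ord (leqnSn K) k).
exists K.+1; apply/asboolP; split => //; exists x; split; first split.
- move=> k; apply/eqP => /rowP/(_ (widen_ord (leqnSn K) k)) /eqP.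
  by rewrite !mxE !eqxx/= oner_eq0.
- exists (range e).
    move=> _ _ [k _ <-] [l _ <-] kl; apply: dotd.
    by apply/eqP => kl'; apply: kl; rewrite kl'.
  move=> k; exists (x k), 1; split; [by exists (widen_ord (leqnSn K) k) | |].
    exact: oner_neq0.
  by rewrite scale1r.
- by move=> i k l _ _ kl; apply: dotd.
Qed.

Definition min_training_length (r : R) u b : nat :=
  ex_minn (admissible_length_exists r u b).

End Training.

Section Randomness.
Variables (R : realType) (d : measure_display) (T : measurableType d).
Variable P : probability T R.

Definition square (s : R) : set (R * R) := `[0, s] `*` `[0, s].

(* Normalized Lebesgue measure on the square; used with [0 < s]. *)
Definition uniform_on_square (s : R) (X : {RV P >-> (R * R)%type}) : Prop :=
  forall A : set (R * R), measurable A ->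
    distribution P X A =
    ((s ^+ 2)^-1%:E *
       (lebesgue_measure \x lebesgue_measure)%E (A `&` square s))%E.

(* Mutual independence: the product rule over every finite subfamily. *)
Definition mutually_independent (X : nat -> {RV P >-> (R * R)%type}) : Prop :=
  forall (J : seq nat) (A : nat -> set (R * R)), uniq J ->
    (forall j, measurable (A j)) ->
    P (\bigcap_(j in [set` J]) (X j @^-1` A j)) =
    (\prod_(j <- J) P (X j @^-1` A j))%E.

End Randomness.

Definition side_length (R : realType) (delta : R) (K : nat) : R :=
  Num.sqrt (K%:R / delta).

(* Main.v *)
(* Cut the square into cells of side 2 r. Two users of a common RRH lie in equal
   or adjacent cells, so four palettes, one for each pair of parities of the cell
   coordinates, suffice: L_K is at most four times the largest cell occupancy.
   In coordinates rescaled to the unit square the cells have side h with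
   K h^2 = c constant, so by a union bound over cells and m-subsets of users some
   cell holds m users with probability at most (1/h + 1)^2 C(K, m) h^(2 m).
   For m just above ln K this is O(K^-2), and Borel-Cantelli concludes. *)
Require Import Defs.
From HB Require Import structures.
From mathcomp Require Import all_boot all_order all_algebra.
From mathcomp Require Import complex.
From mathcomp Require Import all_classical all_reals all_analysis.
From mathcomp Require Import ring lra zify.

Set Implicit Arguments.
Unset Strict Implicit.
Unset Printing Implicit Defensive.

Import Order.TTheory GRing.Theory Num.Theory.
Import numFieldNormedType.Exports.

Local Open Scope classical_set_scope.
Local Open Scope ring_scope.

(** * Bounding the training length by colourings *)

(** The standard basis vectors, indexed by the colours, form an orthogonal pool of length [#|C|];
    each user receives the vector of its colour. *)
Lemma min_training_length_le_colors (R : realType) (K N : nat) (r : R)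
    (u : 'I_K -> R * R) (b : 'I_N -> R * R) (C : finType) (f : 'I_K -> C) :
    (0 < #|C|)%N ->
    (forall (i : 'I_N) (k l : 'I_K), k \in served r u b i ->
       l \in served r u b i -> k != l -> f k != f l) ->
  (min_training_length r u b <= #|C|)%N.
Proof.
move=> C0 fP; rewrite /min_training_length; case: ex_minnP => L _; apply.
apply/asboolP; split=> //.
pose e (k : 'I_#|C|) : 'rV[R[i]]_#|C| := delta_mx 0 k.
have dote k l : k != l -> dotmx (e k) (e l) = 0.
  move=> kl; rewrite dotmxE mxE big1// => j _; rewrite !mxE eqxx/=.
  case: (eqVneq j k) => [->|_]; last by rewrite mul0r.
  by rewrite (negbTE kl) conjC0 mulr0.
exists (fun k => e (enum_rank (f k))); split; first split.
- move=> k; apply/eqP => /rowP/(_ (enum_rank (f k)))/eqP.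
  by rewrite !mxE !eqxx/= oner_eq0.
- exists (range e).
    move=> _ _ [k _ <-] [l _ <-] kl; apply: dote.
    by apply/eqP => kl'; apply: kl; rewrite kl'.
  move=> k; exists (e (enum_rank (f k))), 1; rewrite scale1r oner_neq0.
  by split=> //; exists (enum_rank (f k)).
- move=> i k l ki li kl; apply: dote.
  by rewrite (inj_eq enum_rank_inj); exact: fP ki li kl.
Qed.

(* A user is coloured by its rank inside its cell and the two parities of the
   cell coordinates. *)
Lemma min_training_length_le_cells (R : realType) (K N : nat) (r : R)
    (u : 'I_K -> R * R) (b : 'I_N -> R * R) (c : 'I_K -> nat * nat) (M : nat) :
    (0 < M)%N ->
    (forall (i : 'I_N) (k l : 'I_K), k \in served r u b i ->
       l \in served r u b i ->
       ((c k).1 <= (c l).1.+1)%N && ((c k).2 <= (c l).2.+1)%N) ->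
    (forall k, (#|[set l | c l == c k]%SET| <= M)%N) ->
  (min_training_length r u b <= 4 * M)%N.
Proof.
case: M => // M _ adj occ.
pose below k := [set l : 'I_K | (c l == c k) && (l < k)%N]%SET.
(* [k] lies in its own cell but not in [below k], so its rank is at most [M] and [inord] does not
   alter it. *)
have belowM k : (#|below k| < M.+1)%N.
  apply: leq_trans (occ k); apply: proper_card; apply/fintype.properP; split.
    by apply/fintype.subsetP => l; rewrite !inE => /andP[].
  by exists k; rewrite !inE ?eqxx ?ltnn.
have below_lt k l : c k = c l -> (k < l)%N -> (#|below k| < #|below l|)%N.
  move=> ckl kl; apply: proper_card; apply/fintype.properP; split.
    apply/fintype.subsetP => j; rewrite !inE ckl => /andP[-> jk] /=.
    exact: ltn_trans jk kl.
  by exists k; rewrite !inE ?ltnn ?andbF // ckl eqxx.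
pose f k := (inord #|below k| : 'I_M.+1, odd (c k).1, odd (c k).2).
have -> : (4 * M.+1)%N = #|{: 'I_M.+1 * bool * bool}|.
  by rewrite !card_prod card_ord card_bool; lia.
apply: (@min_training_length_le_colors _ _ _ _ _ _ _ f).
  by rewrite !card_prod card_ord card_bool.
move=> i k l ki li kl; apply: contra_neqN kl => /eqP[fkl o1 o2].
(* Adjacency in both directions keeps each coordinate difference at most 1, and equal parity then
   makes it 0. *)
have ckl : c k = c l.
  have /andP[a1 a2] := adj _ _ _ ki li; have /andP[a3 a4] := adj _ _ _ li ki.
  rewrite (surjective_pairing (c k)) (surjective_pairing (c l)).
  by congr pair; lia.
have {}fkl : #|below k| = #|below l|.
  by move/(congr1 val): fkl; rewrite /= !inordK.
apply: val_inj => /=; case: (ltngtP k l) => // /below_lt H.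
  by have := H ckl; rewrite fkl ltnn.
by have := H (esym ckl); rewrite fkl ltnn.
Qed.

(** * Geometry and measure of the cells *)

(* Clamping at [n] leaves finitely many cells and keeps neighbouring points in
   neighbouring cells, so the null event that a user falls outside the square
   needs no separate treatment. *)
Definition cell (R : realType) (n : nat) (h x : R) : nat :=
  minn n (Num.truncn (x / h)).

Lemma cell_adjacent (R : realType) (n : nat) (h x y : R) :
  0 < h -> `|x - y| < h -> (cell n h x <= (cell n h y).+1)%N.
Proof.
move=> h0 /ltr_normlW xy.
suff : (Num.truncn (x / h) <= (Num.truncn (y / h)).+1)%N by rewrite /cell; lia.
rewrite truncn_le_nat ltr_pdivrMr//.
have : y / h < (Num.truncn (y / h)).+1%:R by exact: truncnS_gt.
rewrite ltr_pdivrMr// -[_.+2%:R]natr1 mulrDl mul1r.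
by move: xy; lra.
Qed.

Lemma measurable_cell (R : realType) (n : nat) (h : R) (i : nat) :
  0 < h -> measurable [set x | cell n h x = i].
Proof.
move=> h0.
(* Superlevel sets are simpler than level sets: each is the whole line, empty or a closed half-line.
   A level set is the difference of two consecutive ones. *)
have mge j : measurable [set x | (j <= cell n h x)%N].
  case: j => [|j].
    by rewrite (_ : [set x | _] = setT)//; apply/seteqP; split.
  have [jn|nj] := leqP j.+1 n; last first.
    rewrite (_ : [set x | _] = set0)//; apply/seteqP; split => // x /=.
    by rewrite /cell; lia.
  rewrite (_ : [set x | _] = `[j.+1%:R * h, +oo[%classic) //.
  apply/seteqP; split => x /=; rewrite in_itv/= andbT /cell leq_min jn/=.
    by rewrite truncn_gt_nat ler_pdivlMr.
  by rewrite truncn_gt_nat ler_pdivlMr.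
rewrite (_ : [set x | _] = [set x | (i <= cell n h x)%N] `\`
                           [set x | (i.+1 <= cell n h x)%N]).
  exact: measurableD.
apply/seteqP; split => x /=; first by move=> ->; split; lia.
by move=> [? /negP]; lia.
Qed.

(** On the unit interval [x / h <= h^-1 < n.+1], so the clamping is inactive there. *)
Lemma cell_sub_itv (R : realType) (n : nat) (h x : R) :
  0 < h -> h^-1 < n.+1%:R -> 0 <= x <= 1 ->
  x \in `[(cell n h x)%:R * h, (cell n h x).+1%:R * h[.
Proof.
move=> h0 hn /andP[x0 x1].
have xh0 : 0 <= x / h by rewrite divr_ge0// ltW.
have -> : cell n h x = Num.truncn (x / h).
  apply/minn_idPr; rewrite truncn_le_nat; apply: le_lt_trans hn.
  by rewrite ler_pdivrMr// mulVf// gt_eqF.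
rewrite in_itv/= -ler_pdivlMr// -ltr_pdivrMr//.
exact: truncn_itv.
Qed.

Lemma measure_bigsetU_le d (T : ringOfSetsType d) (R : realFieldType)
    (mu : {content set T -> \bar R}) (I : Type) (s : seq I) (Q : pred I)
    (F : I -> set T) : (forall i, Q i -> measurable (F i)) ->
  (mu (\big[setU/set0]_(i <- s | Q i) F i) <= \sum_(i <- s | Q i) mu (F i))%E.
Proof.
move=> mF; elim: s => [|i s IH]; first by rewrite !big_nil measure0.
rewrite !big_cons; case: ifPn => // Qi.
apply: le_trans (leeD2l _ IH); apply: measureU2; first exact: mF.
exact: bigsetU_measurable.
Qed.

Definition cell2 (R : realType) (n : nat) (h : R) (x : R * R) : nat * nat :=
  (cell n h x.1, cell n h x.2).

Lemma measurable_cell2 (R : realType) (n : nat) (h : R) (c : nat * nat) :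
  0 < h -> measurable [set x | cell2 n h x = c].
Proof.
move=> h0; rewrite (_ : [set x | _] =
  [set x | cell n h x = c.1] `*` [set x | cell n h x = c.2]).
  by apply: measurableX; exact: measurable_cell.
apply/seteqP; case: c => c1 c2; split=> -[x y] /=; first by case.
by rewrite /cell2 /= => -[-> ->].
Qed.

Lemma prob_cell2_le (R : realType) d (T : measurableType d)
    (P : probability T R) (X : {RV P >-> (R * R)%type}) (n : nat) (h : R)
    (c : nat * nat) :
    uniform_on_square 1 X -> 0 < h -> h^-1 < n.+1%:R ->
  (P (X @^-1` [set x | cell2 n h x = c]) <= (h ^+ 2)%:E)%E.
Proof.
move=> uX h0 hn; have := uX _ (measurable_cell2 n c h0).
rewrite /distribution /pushforward => ->; rewrite expr1n invr1 mul1e.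
pose I k : set R := `[k%:R * h, k.+1%:R * h[%classic.
have mI k : measurable (I k) by exact: measurable_itv.
have lI k : lebesgue_measure (I k) = h%:E.
  rewrite lebesgue_measure_itv/= lte_fin ltr_pM2r// ltr_nat ltnSn -EFinD.
  by rewrite -mulrBl -natrB// subSnn mul1r.
apply: (@le_trans _ _ ((lebesgue_measure \x lebesgue_measure)%E
                         (I c.1 `*` I c.2))).
  apply: le_measure; rewrite ?inE.
  - apply: measurableI; first exact: measurable_cell2.
    by apply: measurableX; exact: measurable_itv.
  - by apply: measurableX; exact: mI.
  - move=> [x y] [/= <- [/=]]; rewrite !in_itv/= => x01 y01.
    by split; exact: cell_sub_itv.
rewrite product_measure1E; [|exact: mI|exact: mI].
by rewrite [X in (X * _)%E]lI [X in (_ * X)%E]lI -EFinM expr2.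
Qed.

(** * Probability of a crowded cell *)

(** The event that some cell holds at least [m] of the first [K] users. The subset [J] becomes a
    list of naturals to match the form of [mutually_independent]. *)
Definition crowded (T : Type) (R : realType) (u : nat -> T -> R * R)
    (K m n : nat) (h : R) : set T :=
  \big[setU/set0]_(c : 'I_n.+1 * 'I_n.+1)
    \big[setU/set0]_(J : {set 'I_K} | #|J| == m)
      \bigcap_(j in [set` map val (enum J)])
        (u j @^-1` [set x | cell2 n h x = (val c.1, val c.2)]).

Lemma measurable_crowded (R : realType) d (T : measurableType d)
    (P : probability T R) (u : nat -> {RV P >-> (R * R)%type}) (K m n : nat)
    (h : R) : 0 < h -> measurable (crowded (fun k => u k) K m n h).
Proof.
move=> h0; apply: bigsetU_measurable => c _; apply: bigsetU_measurable => J _.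
apply: fin_bigcap_measurable; first exact: finite_seq.
by move=> j _; apply: measurable_funPTI; exact: measurable_cell2.
Qed.

Lemma prob_crowded_le (R : realType) d (T : measurableType d)
    (P : probability T R) (u : nat -> {RV P >-> (R * R)%type}) (K m n : nat)
    (h : R) :
    (forall k, uniform_on_square 1 (u k)) -> mutually_independent u ->
    0 < h -> h^-1 < n.+1%:R ->
  (P (crowded (fun k => u k) K m n h) <=
     (n.+1%:R ^+ 2 * ('C(K, m)%:R * (h ^+ 2) ^+ m))%:E)%E.
Proof.
move=> uu iu h0 hn.
have mE c j : measurable (u j @^-1` [set x | cell2 n h x = c]).
  by apply: measurable_funPTI; exact: measurable_cell2.
have mC c (J : seq nat) : measurable (\bigcap_(j in [set` J])
    (u j @^-1` [set x | cell2 n h x = c])).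
  by apply: fin_bigcap_measurable => [|j _]; [exact: finite_seq|exact: mE].
have PJ c (J : {set 'I_K}) : #|J| == m ->
    (P (\bigcap_(j in [set` map val (enum J)])
          (u j @^-1` [set x | cell2 n h x = c])) <= ((h ^+ 2) ^+ m)%:E)%E.
  move=> /eqP <-; rewrite (iu _ (fun=> [set x | cell2 n h x = c])).
  - rewrite cardE -(size_map val); elim: (map _ _) => [|j s IH].
      by rewrite big_nil.
    rewrite big_cons /= exprS EFinM; apply: lee_pmul => //.
      by apply: prode_ge0 => i _.
    exact: prob_cell2_le.
  - by rewrite map_inj_uniq ?enum_uniq//; exact: val_inj.
  - by move=> j; exact: measurable_cell2.
apply: le_trans; first apply: measure_bigsetU_le.
  by move=> c _; exact: bigsetU_measurable.
apply: (@le_trans _ _ (\sum_(c : 'I_n.+1 * 'I_n.+1)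
  ('C(K, m)%:R * (h ^+ 2) ^+ m)%:E)%E).
  apply: lee_sum => c _; apply: le_trans; first exact: measure_bigsetU_le.
  apply: (@le_trans _ _ (\sum_(J : {set 'I_K} | #|J| == m)
    ((h ^+ 2) ^+ m)%:E)%E).
    by apply: lee_sum => J; exact: PJ.
  rewrite sumEFin sumr_const lee_fin -[leLHS]mulr_natl.
  by rewrite -[K in 'C(K, _)]card_ord -card_draws cardsE.
rewrite sumEFin sumr_const card_prod card_ord lee_fin -[leLHS]mulr_natl natrM.
by rewrite expr2.
Qed.

Lemma cell_occupancy_lt (T : Type) (R : realType) (u : nat -> T -> R * R)
    (K m n : nat) (h : R) (w : T) : ~ crowded u K m n h w ->
  forall k : 'I_K, (#|[set l : 'I_K |
    cell2 n h (u l w) == cell2 n h (u k w)]%SET| < m)%N.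
Proof.
move=> nw k; rewrite ltnNge; apply/negP => mS; apply: nw.
set S := finset _ in mS.
pose J := [set l in take m (enum S)]%SET.
have Jm : #|J| == m.
  rewrite cardsE (card_uniqP _) ?take_uniq ?enum_uniq//.
  by rewrite size_takel// -cardE.
have cellP x : (cell n h x < n.+1)%N by rewrite ltnS geq_minl.
rewrite /crowded -bigcup_seq.
exists (Ordinal (cellP (u k w).1), Ordinal (cellP (u k w).2)) => /=.
  by rewrite mem_index_enum.
rewrite -bigcup_seq_cond; exists J => //=; first by rewrite mem_index_enum.
move=> _ /= /mapP[l lJ ->]; apply/eqP.
by move: lJ; rewrite mem_enum inE => /mem_take; rewrite mem_enum inE.
Qed.

(** * Numerical estimates and summability *)

Lemma bin_le_expn (n m : nat) : ('C(n, m) * m`! <= n ^ m)%N.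
Proof.
rewrite bin_ffact; elim: m n => [|m IH] n; first by rewrite expn0.
by rewrite ffactnSr expnSr leq_mul// leq_subr.
Qed.

(* With [c = K * h^2] the mean cell occupancy and [m >= ln K], the inequality
   [x ^ m / m! <= exp x] at [x = c * exp 3] makes [c ^ m / m!] beat [K ^ 3]. *)
Lemma crowded_bound_le (R : realType) (c h : R) (K m n : nat) :
    0 < h -> (0 < K)%N -> K%:R * h ^+ 2 = c -> n%:R <= h^-1 ->
    ln K%:R <= m.+1%:R :> R ->
  n.+1%:R ^+ 2 * ('C(K, m.+1)%:R * (h ^+ 2) ^+ m.+1) <=
  2 * (c^-1 + 1) * expR (c * expR 3) / K%:R ^+ 2.
Proof.
move=> h0 K0 Kh nh lnm.
have K0R : 0 < K%:R :> R by rewrite ltr0n.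
have K1R : 1 <= K%:R :> R by rewrite ler1n.
have c0 : 0 < c by rewrite -Kh mulr_gt0// exprn_gt0.
have bin : 'C(K, m.+1)%:R * (h ^+ 2) ^+ m.+1 <= c ^+ m.+1 / (m.+1)`!%:R.
  rewrite ler_pdivlMr ?ltr0n ?fact_gt0// -Kh [leRHS]exprMn mulrAC.
  rewrite ler_pM2r ?exprn_gt0 ?exprn_gt0//.
  by rewrite -natrM -natrX ler_nat bin_le_expn.
have K3 : K%:R ^+ 3 <= expR 3 ^+ m.+1 :> R.
  rewrite -expRM_natr -[in leLHS](@lnK _ K%:R) ?posrE// -expRM_natl ler_expR.
  by rewrite ler_pM2l.
have bin3 : 'C(K, m.+1)%:R * (h ^+ 2) ^+ m.+1 * K%:R ^+ 3 <= expR (c * expR 3).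
  apply: (@le_trans _ _ ((c * expR 3) ^+ m.+1 / (m.+1)`!%:R)).
    rewrite [(c * _) ^+ _]exprMn [leRHS]mulrAC; apply: ler_pM => //.
    by rewrite mulr_ge0// exprn_ge0// exprn_ge0// ltW.
  have cE0 : 0 <= c * expR 3 by rewrite mulr_ge0 ?expR_ge0 ?ltW.
  by apply: le_trans (expR_ge1Dxn m cE0); rewrite lerDr.
have cells : n.+1%:R ^+ 2 <= 2 * (c^-1 + 1) * K%:R.
  apply: (@le_trans _ _ ((h^-1 + 1) ^+ 2)).
    by rewrite ler_pXn2r// ?nnegrE ?addr_ge0 ?invr_ge0 ?(ltW h0)// -natr1 lerD2r.
  have -> : 2 * (c^-1 + 1) * K%:R = 2 * h^-1 ^+ 2 + 2 * K%:R.
    by rewrite -Kh; field; rewrite !gt_eqF.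
  (* With [x = h^-1], [(x - 1)^2 >= 0] gives [(x + 1)^2 <= 2 x^2 + 2]. *)
  have := sqr_ge0 (h^-1 - 1); move: K1R; nra.
(* The number of cells costs one factor [K], so [K^-3] per cell leaves [K^-2]. *)
have -> : 2 * (c^-1 + 1) * expR (c * expR 3) / K%:R ^+ 2 =
    2 * (c^-1 + 1) * K%:R * (expR (c * expR 3) / K%:R ^+ 3).
  by field; rewrite !gt_eqF.
apply: ler_pM => //.
- by rewrite mulr_ge0// exprn_ge0// exprn_ge0// ltW.
- by rewrite ler_pdivlMr// exprn_gt0.
Qed.

(** Since [1 / x^2 <= 2 / (x (x + 1))] for [x >= 1], the partial sums are dominated by a telescoping
    sum bounded by [2 * C]. *)
Lemma nneseries_inv_sqr_lty (R : realType) (C : R) (a : nat -> \bar R) :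
    0 <= C -> (forall k, 0 <= a k)%E ->
    (forall k, a k <= (C / k.+1%:R ^+ 2)%:E)%E ->
  (\sum_(k <oo) a k < +oo)%E.
Proof.
move=> C0 a0 aC; apply: (@le_lt_trans _ _ (2 * C)%:E); last exact: ltry.
apply: lime_le; first exact: is_cvg_nneseries.
apply: nearW => n.
pose f k : R := - (2 * C / k.+1%:R).
apply: (@le_trans _ _ (\sum_(0 <= k < n) (f k.+1 - f k)%:E)%E).
  apply: lee_sum => k _; apply: le_trans (aC k) _; rewrite lee_fin.
  have : 1 <= k.+1%:R :> R by rewrite ler1n.
  rewrite /f -[k.+2%:R]natr1; move: (k.+1%:R : R) => x x1.
  have -> : - (2 * C / (x + 1)) - - (2 * C / x) = C * (2 / (x * (x + 1))).
    by field; rewrite !gt_eqF//; lra.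
  rewrite ler_wpM2l// -div1r ler_pdivlMr ?mulr_gt0//; try lra.
  by rewrite mulrAC ler_pdivrMr ?exprn_gt0//; nra.
rewrite sumEFin telescope_sumr// lee_fin /f opprK divr1 gerDr oppr_le0.
by rewrite divr_ge0// mulr_ge0.
Qed.

(** * From occupancy to the almost-sure bound *)

(** Through their common RRH the users are less than [2 * r] apart in each coordinate; dividing by
    [s] gives exactly the cell side. *)
Lemma served_cell2_adjacent (R : realType) (K N : nat) (r s : R)
    (u : 'I_K -> R * R) (b : 'I_N -> R * R) (n : nat) (i : 'I_N)
    (k l : 'I_K) :
    0 < r -> 0 < s ->
    k \in served r (fun k => s *: u k) b i ->
    l \in served r (fun k => s *: u k) b i ->
  let c j := cell2 n (2 * r / s) (u j) in
  ((c k).1 <= (c l).1.+1)%N && ((c k).2 <= (c l).2.+1)%N.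
Proof.
move=> r0 s0; rewrite !inE !prod_normE !gt_max /=.
move=> /andP[k1 k2] /andP[l1 l2].
have close (x y z : R) : `|z - s * x| < r -> `|z - s * y| < r ->
    `|x - y| < 2 * r / s.
  move=> zx zy; rewrite ltr_pdivlMr// -[X in _ * X](gtr0_norm s0) -normrM.
  have -> : (x - y) * s = (z - s * y) - (z - s * x) by ring.
  by apply: le_lt_trans (ler_normB _ _) _; lra.
have h0 : 0 < 2 * r / s by rewrite divr_gt0// mulr_gt0.
by apply/andP; split; apply: cell_adjacent => //; [exact: close k1 l1|
                                                   exact: close k2 l2].
Qed.

Lemma limn_esup_le_near (R : realType) (a : nat -> \bar R) (C : \bar R) :
  (\forall k \near \oo, (a k <= C)%E) -> (limn_esup a <= C)%E.
Proof.
move=> aC; apply: ge_ereal_inf; exists (ereal_sup (a @` [set k | a k <= C]%E)).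
  by exists [set k | (a k <= C)%E].
by apply: ge_ereal_sup => _ [k /= kC <-].
Qed.

Theorem corollary1 (R : realType) (d : measure_display) (T : measurableType d)
    (P : probability T R) (delta r : R) (N : nat -> nat)
    (u : nat -> {RV P >-> (R * R)%type})
    (b : forall K : nat, 'I_(N K) -> {RV P >-> (R * R)%type})
    (delta_gt0 : 0 < delta) (r_gt0 : 0 < r)
    (N_ge1 : forall K, (0 < K)%N -> (0 < N K)%N)
    (u_uniform : forall k, uniform_on_square 1 (u k))
    (u_indep : mutually_independent u)
    (b_uniform : forall K, (0 < K)%N ->
       forall i : 'I_(N K), uniform_on_square (side_length delta K) (b K i)) :
  {ae P, forall w : T,
    (limn_esup (fun K : nat =>
       (((min_training_length r
            (fun k : 'I_K => side_length delta K *: u k w)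
            (fun i : 'I_(N K) => b K i w))%:R : R) / ln K%:R)%R%:E)
     < +oo :> \bar R)%E}.
Proof.
pose s K := side_length delta K; pose h K := 2 * r / s K.
pose m K := Num.truncn (ln K%:R : R); pose n K := Num.truncn (h K)^-1.
(* The shift to [K.+1] avoids [K = 0], where the square has side 0. *)
pose F K := crowded (fun k => u k) K.+1 (m K.+1).+1 (n K.+1) (h K.+1).
have s0 K : (0 < K)%N -> 0 < s K.
  by move=> K0; rewrite sqrtr_gt0 divr_gt0// ltr0n.
have h0 K : (0 < K)%N -> 0 < h K.
  by move=> K0; rewrite divr_gt0 ?s0// mulr_gt0.
have mF K : measurable (F K) by exact/measurable_crowded/h0.
pose c := 4 * r ^+ 2 * delta.
have Kh K : (0 < K)%N -> K%:R * h K ^+ 2 = c.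
  move=> K0; have K0R : 0 < K%:R :> R by rewrite ltr0n.
  rewrite /h expr_div_n sqr_sqrtr ?divr_ge0 ?ltW//.
  by rewrite /c; field; rewrite !gt_eqF.
have c0 : 0 < c by rewrite !mulr_gt0// exprn_gt0.
have F0 : P (lim_sup_set F) = 0.
  apply: lim_sup_set_cvg0 => //.
  apply: (@nneseries_inv_sqr_lty _ (2 * (c^-1 + 1) * expR (c * expR 3))).
  - by rewrite !mulr_ge0 ?expR_ge0 ?addr_ge0 ?invr_ge0 ?(ltW c0).
  - by move=> k.
  - move=> k; apply: le_trans.
      by apply: prob_crowded_le => //; [exact: h0|exact: truncnS_gt].
    rewrite lee_fin; apply: crowded_bound_le => //; first exact: h0.
    + exact: Kh.
    + by rewrite truncn_le invr_ge0 ltW// h0.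
    + exact/ltW/truncnS_gt.
(* The exceptional set consists of the outcomes with infinitely many crowded [K]; outside it the
   cells are uncrowded from some [k0] on. *)
exists (lim_sup_set F); split=> //.
  by apply: bigcap_measurable => // k _; exact: bigcup_measurable.
move=> w /=; apply: contra_notP => /existsNP[k0 /not_implyP[_ nF]].
(* The constant 8 comes from [4 * (m K).+1 <= 4 * (ln K + 1) <= 8 * ln K], valid once
   [ln K >= 1]. *)
apply: le_lt_trans (ltry 8); apply: limn_esup_le_near.
near=> K.
have K0 : (0 < K)%N by near: K; exact: nbhs_infty_gt.
have lnK1 : 1 <= ln K%:R :> R.
  rewrite -[leLHS](@expRK R) ler_ln ?posrE ?expR_gt0 ?ltr0n//.
  apply/ltW/(lt_le_trans (truncnS_gt _)); rewrite ler_nat.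
  by near: K; exact: nbhs_infty_ge.
have nFK : ~ crowded (fun k => u k) K (m K).+1 (n K) (h K) w.
  move=> FK; apply: nF; exists K.-1; last by rewrite /F prednK.
  by rewrite /= -ltnS prednK//; near: K; exact: nbhs_infty_gt.
rewrite lee_fin ler_pdivrMr; last exact: lt_le_trans lnK1.
apply: (@le_trans _ _ (4 * (m K).+1)%:R).
  rewrite ler_nat; apply: (@min_training_length_le_cells _ _ _ _ _ _
    (fun k => cell2 (n K) (h K) (u k w))) => //.
  - by move=> i k l; apply: served_cell2_adjacent => //; exact: s0.
  - by move=> k; exact/ltnW/(cell_occupancy_lt nFK).
rewrite natrM -natr1.
have : (m K)%:R <= ln K%:R :> R by rewrite truncn_le (le_trans _ lnK1).
by move: lnK1; lra.
Unshelve. all: by end_near.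
Qed.
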